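(* Let $a$ be a positive integer, let $n>2a$ be an integer, let $\sigma$ be a uniformly random permutation of $\{1,\ldots,n\}$, and write $p=\Pr[D_{a,a}(\sigma)=0]$. Then $p\le\frac1n$. Furthermore, unless $a=2$ and $n=5$ the inequality is strict, and unless $n=2a+1$ we have $\frac1n-p\ge\frac1{3n(n-1)}$.
   Context: For positive integers $a,b$ with $a+b<n$ and a permutation $\sigma$ of $\{1,\ldots,n\}$, define $D_{a,b}(\sigma)=\sum_{i=1}^{a}\sigma(i)-\sum_{i=a+1}^{a+b}\sigma(i)$. *)

(* Defs.v *)
From mathcomp Require Import all_boot all_order all_fingroup all_algebra.
Set Implicit Arguments.
Unset Strict Implicit.
Unset Printing Implicit Defensive.
Import Order.TTheory GRing.Theory Num.Theory.
Local Open Scope ring_scope.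

(* Ordinals are 0-based: the position i in {1, ..., n} is the ordinal of value
   i - 1, and the value sigma(i) in {1, ..., n} is (s _).+1. *)
Definition D (n a b : nat) (s : 'S_n) : int :=
  \sum_(i < n | (i < a)%N) ((s i).+1)%:Z
  - \sum_(i < n | (a <= i < a + b)%N) ((s i).+1)%:Z.

Definition uniform_Pr (T : finType) (A : {set T}) : rat :=
  #|A|%:R / #|T|%:R.

(* Main.v *)
Require Import Defs.
From mathcomp Require Import all_boot all_order all_fingroup all_algebra.
From mathcomp Require Import zify ring lra.
Set Implicit Arguments.
Unset Strict Implicit.
Unset Printing Implicit Defensive.
Import Order.TTheory GRing.Theory Num.Theory.

(** Record a permutation by the word whose [j]-th letter tells whether the
    value [j] is taken on the first block of positions ([A]), on the second
    ([B]) or elsewhere ([O]). Then [D] is the moment of the word, and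
    [p = G / W], where [W] counts the words with [a] letters [A] and [a] letters
    [B], and [G] those of moment [0].

    Each [A] of a word is the end of an initial part, of some length [k], of a
    maximal run of [A]s, so [a G] is the sum over [k] of the number of marked
    blocks [A^k] that start a run in a word of moment [0]. Moving such a block
    through the rest of the word raises the moment by [k] past an [O], by [2k]
    past a [B] and by [0] past an [A]; hence the rest determines the place of
    the block, and its moment must lie in a fixed class modulo [k].

    For [k >= 2] the divisibility halves the count: swapping two adjacent
    letters exactly one of which is [O] changes the moment by [1]. For [k = 1]
    the word is turned into a cyclic one. Rotating it changes the moment by
    multiples of [n], at least [a] of its [n] rotations have nonzero moment,
    and an [A] travelling once around the other [n - 1] letters meets the
    residue [0] modulo [n] at most once outside runs. The words that both start
    and end with [A] have to be added back; they are few by the block argument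
    again.

    The sum of these bounds suffices except for [a = 2], [n <= 11] and for
    [a = 3], [n = 8], where the words of moment [0] are counted by computation. *)

(** * Counting words *)

Section CountWords.
Variable T : finType.
Implicit Types (m : nat) (P Q : pred (seq T)).

Definition nwords m P : nat := #|[set t : m.-tuple T | P t]|.

Lemma leq_nwords m P Q :
  (forall w, size w = m -> P w -> Q w) -> nwords m P <= nwords m Q.
Proof.
move=> PQ; apply/subset_leq_card/subsetP => t; rewrite !inE.
by apply: PQ; rewrite size_tuple.
Qed.

Lemma eq_nwords m P Q : P =1 Q -> nwords m P = nwords m Q.
Proof. by move=> eqPQ; apply: eq_card => t; rewrite !inE eqPQ. Qed.

Lemma nwords_pred0 m P : P =1 xpred0 -> nwords m P = 0.
Proof. by move=> P0; apply: eq_card0 => t; rewrite inE P0. Qed.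

Lemma nwordsID m P Q :
  nwords m [pred w | P w & Q w] + nwords m [pred w | P w & ~~ Q w] = nwords m P.
Proof.
rewrite -[RHS](cardsID [set t : m.-tuple T | Q t]).
by congr (_ + _); apply: eq_card => t; rewrite !inE // andbC.
Qed.

Lemma nwords0 P : nwords 0 P = P [::].
Proof.
case: (boolP (P [::])) => Pnil /=.
  by rewrite -[RHS](card_tuple 0 T); apply: eq_card => t; rewrite !inE tuple0.
by apply: eq_card0 => t; rewrite !inE tuple0 (negbTE Pnil).
Qed.

Lemma nwordsS m P :
  nwords m.+1 P = \sum_(x : T) nwords m (fun w => P (x :: w)).
Proof.
have nwordsE k Q : nwords k Q = \sum_(t : k.-tuple T | Q t) 1.
  by rewrite sum1dep_card.
rewrite nwordsE (eq_bigr _ (fun x _ => nwordsE m _)) pair_big_dep /=.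
rewrite (reindex (fun p : T * m.-tuple T => [tuple of p.1 :: p.2])) //=.
pose uncons (t : m.+1.-tuple T) := (thead t, [tuple of behead t]).
exists uncons => /= [[x t]|t] _.
  by congr (_, _); apply: val_inj.
by rewrite -tuple_eta.
Qed.

Lemma leq_card_nwords (I : finType) (S : {pred I}) m P (f : I -> seq T) :
  {in S &, injective f} -> {in S, forall i, size (f i) = m /\ P (f i)} ->
  #|S| <= nwords m P.
Proof.
move=> f_inj fP; rewrite cardE -(size_map f) /nwords cardE -(size_map val).
apply: uniq_leq_size => [|_ /mapP[i iS ->]].
  rewrite map_inj_in_uniq ?enum_uniq // => i j.
  by rewrite !mem_enum; apply: f_inj.
rewrite mem_enum in iS; have [/eqP fi_m Pfi] := fP i iS.
by apply/mapP; exists (Tuple fi_m); rewrite ?mem_enum ?inE.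
Qed.

End CountWords.

Lemma nwords_map (T U : finType) (f : T -> U) m (P : pred (seq U)) :
  bijective f -> nwords m (fun w => P (map f w)) = nwords m P.
Proof.
move=> f_bij; elim: m P => [|m IHm] P; first by rewrite !nwords0.
rewrite !nwordsS (reindex f) /=; last exact: onW_bij.
by apply: eq_bigr => x _; apply: IHm.
Qed.

Lemma pair_ind (T : Type) (P : seq T -> Prop) :
  P [::] -> (forall x, P [:: x]) -> (forall x y s, P s -> P [:: x, y & s]) ->
  forall s, P s.
Proof.
move=> P0 P1 P2 s; suff [] : P s /\ forall x, P (x :: s) by [].
by elim: s => [|x s [Ps Pxs]]; split=> // y; apply: P2.
Qed.

Lemma last_nseq (T : Type) k (x y : T) : 0 < k -> last y (nseq k x) = x.
Proof. by case: k => // k _; elim: k. Qed.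

(** * Letters, moments and contents *)

Local Notation letter := (option bool).
Local Notation A := (Some true : letter).
Local Notation B := (Some false : letter).
Local Notation O := (None : letter).

Lemma big_letter (F : letter -> nat) : \sum_x F x = F A + F B + F O.
Proof.
rewrite (bigD1 O) // (bigD1 A) //= (bigD1 B) //= big1 ?addn0 1?addnC //.
by case=> [[]|].
Qed.

Section Moment.
Local Open Scope ring_scope.
Implicit Types u v w z : seq letter.

Definition charge (x : letter) : int :=
  match x with Some true => 1 | Some false => -1 | None => 0 end.

Fixpoint net w : int := if w is x :: w' then charge x + net w' else 0.

Fixpoint moment w : int := if w is x :: w' then net w + moment w' else 0.

Lemma net_cat u v : net (u ++ v) = net u + net v.
Proof. by elim: u => [|x u IHu] /=; rewrite ?add0r // IHu addrA. Qed.

Lemma net_rcons w x : net (rcons w x) = net w + charge x.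
Proof. by rewrite -cats1 net_cat /= addr0. Qed.

Lemma netE w : net w = (count_mem A w)%:Z - (count_mem B w)%:Z.
Proof. by elim: w => //= x w ->; case: x => [[]|] /=; lia. Qed.

Lemma perm_net u v : perm_eq u v -> net u = net v.
Proof. by move=> /seq.permP uv; rewrite !netE !uv. Qed.

Lemma net_nseqA k : net (nseq k A) = k%:Z.
Proof. by rewrite netE !count_nseq /= mul1n mul0n subr0. Qed.

Lemma net_le_size w : net w <= (size w)%:Z.
Proof.
have : (count_mem A w <= size w)%N by exact: count_size.
by rewrite netE; lia.
Qed.

Lemma net_eq_size_nil x w : net w = (size w)%:Z -> last x w != A -> w = [::].
Proof.
rewrite netE => net_w; have : (count_mem A w <= size w)%N by exact: count_size.
move=> leAw; have eqAw : count_mem A w = size w by lia.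
have /all_pred1P-> : all (pred1 A) w by rewrite all_count eqAw.
by case: w {net_w leAw eqAw} => // y w; rewrite last_nseq ?eqxx.
Qed.

Lemma moment_cat u v :
  moment (u ++ v) = moment u + moment v + (size u)%:Z * net v.
Proof.
elim: u => [|x u IHu] /=; first by rewrite mul0r add0r addr0.
by rewrite IHu net_cat; lia.
Qed.

Lemma moment_sum (n : nat) (w : n.-tuple letter) :
  moment w = \sum_(j < n) (j.+1)%:Z * charge (tnth w j).
Proof.
have net_sum u : net u = \sum_(x <- u) charge x.
  by elim: u => [|x u IHu]; rewrite ?big_nil ?big_cons //= IHu.
elim: n w => [|n IHn] w; first by rewrite tuple0 big_ord0.
case/tupleP: w => x w; rewrite big_ord_recl tnth0 /= {}IHn net_sum big_tuple.
rewrite mul1r -addrA -big_split /=; congr (_ + _).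
by apply: eq_bigr => j _; rewrite tnthS (intS (bump 0 j)) mulrDl mul1r.
Qed.

(* Moving the block to the right past [z] raises the places of its letters by
   [size z] and lowers those of the letters of [z] by [k]. *)
Lemma moment_shift_block u k z v :
  moment (u ++ z ++ nseq k A ++ v) - moment (u ++ nseq k A ++ z ++ v)
  = k%:Z * ((size z)%:Z - net z).
Proof. by rewrite !moment_cat !net_cat net_nseqA size_nseq; ring. Qed.

Lemma moment_rot c w : net w = 0 ->
  moment (rot c w) = moment w + (size w)%:Z * net (take c w).
Proof.
rewrite /rot; move: (take c w) (drop c w) (cat_take_drop c w) => u v <-.
rewrite net_cat size_cat !moment_cat PoszD => net0.
have -> : net v = - net u by lia.
by ring.
Qed.

End Moment.

Definition content a b (w : seq letter) : bool :=
  (count_mem A w == a) && (count_mem B w == b).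

Lemma contentP a b w :
  reflect (count_mem A w = a /\ count_mem B w = b) (content a b w).
Proof. by apply: (iffP andP) => [[/eqP-> /eqP->]|[-> ->]]. Qed.

Lemma content_net a b w : content a b w -> net w = (a%:Z - b%:Z)%R.
Proof. by case/contentP=> wA wB; rewrite netE wA wB. Qed.

Lemma perm_content a b u v : perm_eq u v -> content a b u = content a b v.
Proof. by move=> /seq.permP uv; rewrite /content !uv. Qed.

Local Notation ncontent m a b := (nwords m (content a b)).
Local Notation nmoment m a b v :=
  (nwords m [pred w | content a b w & moment w == v%R]).

Lemma nwords_count m t : nwords m [pred u | count id u == t] = 'C(m, t).
Proof.
elim: m t => [|m IHm] t; first by rewrite nwords0 bin0n eq_sym.
rewrite nwordsS big_bool /=; case: t => [|t].
  by rewrite (nwords_pred0 (T := bool)) // add0n IHm !bin0.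
by rewrite !IHm binS addnC.
Qed.

Lemma nwords_contentS m a b P :
  nwords m.+1 [pred w | content a b w & P w] =
    (if a is a'.+1 then nwords m [pred w | content a' b w & P (A :: w)] else 0)
  + (if b is b'.+1 then nwords m [pred w | content a b' w & P (B :: w)] else 0)
  + nwords m [pred w | content a b w & P (O :: w)].
Proof.
rewrite nwordsS big_letter; congr (_ + _ + _).
  by case: a => [|a]; [apply: nwords_pred0 | apply: eq_nwords].
case: b => [|b]; last exact: eq_nwords.
by apply: nwords_pred0 => w; rewrite /content /= andbF.
Qed.

(* A word is determined by the places of its charged letters and by the sequence
   of their signs. *)
Lemma nwords_content_mask m a b (Q : pred (seq bool)) :
  nwords m [pred w | content a b w & Q (map isSome w)] =
  nwords m [pred u | count id u == a + b & Q u] * 'C(a + b, a).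
Proof.
elim: m a b Q => [|m IHm] a b Q.
  rewrite !nwords0 /content /= !(eq_sym 0) addn_eq0.
  by case: a b => [|a] [|b]; rewrite ?muln1.
rewrite nwords_contentS nwordsS big_bool /=.
pose Q' x u := Q (x :: u).
rewrite (IHm _ _ (Q' false)) mulnDl; congr (_ + _).
case: a b => [|a] [|b]; rewrite ?(IHm _ _ (Q' true));
  rewrite ?addn0 ?add0n ?bin0 ?binn ?muln1 //.
- by rewrite nwords_pred0.
- by rewrite !addnS !addSn [in RHS]binS mulnDr addnC.
Qed.

Lemma ncontentE m a b : ncontent m a b = 'C(m, a + b) * 'C(a + b, a).
Proof.
apply: etrans (etrans (nwords_content_mask m a b xpredT) _).
  by apply: eq_nwords => w /=; rewrite andbT.
rewrite -(nwords_count m); congr (_ * _).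
by apply: eq_nwords => u /=; rewrite andbT.
Qed.

Lemma ncontent_gt0 m a b : a + b <= m -> 0 < ncontent m a b.
Proof. by move=> abm; rewrite ncontentE muln_gt0 !bin_gt0 abm leq_addr. Qed.

Lemma mul_ncontent_diag m a b :
  m.+1 * ncontent m a b = a.+1 * ncontent m.+1 a.+1 b.
Proof.
rewrite !ncontentE mulnA addSn mul_bin_diag -mulnA mulnCA.
by rewrite [X in _ * X]mul_bin_diag; ring.
Qed.

Lemma sum_ncontent_diag c a b :
  c.+1 * (\sum_(j < a) ncontent (c + j) j b) = a * ncontent (c + a) a b.
Proof.
elim: a => [|a IHa]; first by rewrite big_ord0 muln0.
rewrite big_ord_recr mulnDr IHa -mulnDl addnS [a + c]addnC.
by rewrite mul_ncontent_diag addnS.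
Qed.

(** * Divisibility of the moment *)

(* The places are paired as (1,2), (3,4), ...: swapping the first pair with
   exactly one neutral letter is an involution that changes the moment by one,
   except on the rigid words, which have no such pair. *)
Fixpoint swap_mixed (w : seq letter) : seq letter :=
  if w is [:: x, y & w'] then
    if isSome x == isSome y then [:: x, y & swap_mixed w'] else [:: y, x & w']
  else w.

Fixpoint rigid (u : seq bool) : bool :=
  if u is [:: x, y & u'] then (x == y) && rigid u' else true.

Lemma swap_mixedK : involutive swap_mixed.
Proof.
elim/pair_ind=> [//|//|x y w IHw] /=; case: ifP => /= xy.
  by rewrite xy IHw.
by rewrite eq_sym xy.
Qed.

Lemma perm_swap_mixed w : perm_eq (swap_mixed w) w.
Proof.
elim/pair_ind: w => [//|//|x y w IHw] /=; case: ifP => _.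
  by rewrite !perm_cons.
by rewrite -(perm_catCA [:: x] [:: y] w).
Qed.

Lemma moment_swap_mixed w : ~~ rigid (map isSome w) ->
  absz (moment (swap_mixed w) - moment w)%R = 1.
Proof.
elim/pair_ind: w => [//|//|x y w IHw] /=; case: ifP => /= xy nrigid_w.
  by rewrite -(IHw nrigid_w) (perm_net (perm_swap_mixed w)); congr absz; ring.
by case: x y xy {nrigid_w} => [[]|] [[]|] //= _; lia.
Qed.

Lemma leq_nwords_dvd_rigid k m a b s : 1 < k ->
  2 * nwords m [pred w | content a b w & (k%:Z %| (moment w + s)%R)%Z]
  <= ncontent m a b + nwords m [pred w | content a b w & rigid (map isSome w)].
Proof.
move=> k_gt1; pose dvd w := (k%:Z %| (moment w + s)%R)%Z.
pose rgd (w : seq letter) := rigid (map isSome w).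
rewrite -(nwordsID m (content a b) dvd) mul2n -addnn -addnA leq_add2l addnC.
rewrite -[X in X <= _](nwordsID m _ rgd) leq_add //.
  by apply: leq_nwords => w _ /= /andP[/andP[-> _]].
pose swap (t : m.-tuple letter) := swap_mixed t.
apply: (leq_card_nwords (f := swap)) => [t u _ _|t]; rewrite /swap.
  by move/(inv_inj swap_mixedK)/val_inj.
rewrite !inE /= => /andP[/andP[ct dvd_t] /moment_swap_mixed swap1].
rewrite (perm_size (perm_swap_mixed t)) size_tuple; split=> //.
rewrite (perm_content _ _ (perm_swap_mixed t)) ct; apply/negP => dvd_swap.
have := rpredB dvd_swap dvd_t; rewrite opprD addrACA subrr addr0.
by rewrite dvdzE swap1 dvdn1; lia.
Qed.

Definition nrigid m t : nat :=
  if ~~ odd m && odd t then 0 else 'C(m./2, t./2).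

Lemma nwords_rigid m t :
  nwords m [pred u | count id u == t & rigid u] = nrigid m t.
Proof.
elim/ltn_ind: m t => -[|[|m]] /= IHm t.
- by rewrite nwords0 /nrigid /= andbT bin0n; case: t => [|[|t]] //=; case: odd.
- rewrite nwordsS big_bool !nwords0 /nrigid /= !andbT.
  by case: t => [|[|[|t]]] //=; rewrite bin0n.
have nwords_andF (P : pred (seq bool)) : nwords m (fun u => P u && false) = 0.
  by apply: nwords_pred0 => u; rewrite /= andbF.
rewrite nwordsS big_bool !nwordsS !big_bool /= !nwords_andF addn0 add0n.
have -> : nwords m (fun u => (0 + (0 + count id u) == t) && rigid u) =
    nrigid m t by exact: (IHm m (leqnSn _)).
case: t => [|[|t]].
- by rewrite nwords_pred0 // /nrigid /= !andbF !bin0.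
- by rewrite nwords_pred0 // /nrigid /= !negbK !bin0.
have -> : nwords m (fun u => (1 + (1 + count id u) == t.+2) && rigid u) =
    nrigid m t by exact: (IHm m (leqnSn _)).
by rewrite /nrigid /= !negbK binS addnC; case: ifP.
Qed.

Lemma leq_mul_bin p q i j : 'C(p, i) * 'C(q, j) <= 'C(p + q, i + j).
Proof.
rewrite -binomial.Vandermonde (bigD1 (inord i)) //= inordK ?ltnS ?leq_addr //.
by rewrite addKn leq_addr.
Qed.

Lemma leq_bin_double h s : 0 < s < h -> h.*2.-1 * 'C(h, s) <= 'C(h.*2, s.*2).
Proof.
wlog s_le_half : s / s.*2 <= h => [bound_small|].
  case: (leqP s.*2 h) => [|s_gt_half] s_bounds; first exact: bound_small.
  rewrite -bin_sub; last by lia.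
  rewrite -[X in _ <= X]bin_sub; last by lia.
  by rewrite -doubleB; apply: bound_small; lia.
elim: s s_le_half => // s IHs s_le_half /andP[_ s_lt_h].
have [->|s_gt0] := posnP s; first by rewrite bin1 bin2 -doubleMl doubleK mulnC.
have {}IHs : h.*2.-1 * 'C(h, s) <= 'C(h.*2, s.*2) by apply: IHs; lia.
have binhS := mul_bin_left h s.
have bin2hSS : s.+1 * s.*2.+1 * 'C(h.*2, s.+1.*2) =
    (h - s) * (h.*2 - s.*2.+1) * 'C(h.*2, s.*2).
  have := congr1 (muln (h.*2 - s.*2.+1)) (mul_bin_left h.*2 s.*2).
  have := congr1 (muln s.*2.+1) (mul_bin_left h.*2 s.*2.+1).
  by rewrite -doubleB doubleS; move: (h - s) (h.*2 - _) => d e; lia.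
rewrite -(leq_pmul2l (_ : 0 < s.+1 * s.*2.+1)) // bin2hSS.
have -> : s.+1 * s.*2.+1 * (h.*2.-1 * 'C(h, s.+1)) =
    (h - s) * s.*2.+1 * (h.*2.-1 * 'C(h, s)).
  by rewrite mulnAC mulnCA binhS; ring.
by rewrite leq_mul // leq_mul2l; apply/orP; right; lia.
Qed.

Lemma leq_bin_doubleS h s : 0 < s <= h -> h.*2 * 'C(h, s) <= 'C(h.*2.+1, s.*2).
Proof.
case: s => // s /= s_lt_h; have [s_eq|s_neq] := eqVneq s.+1 h.
  by rewrite s_eq !binn muln1 binSn.
rewrite doubleS binS.
apply: leq_trans (_ : h.*2.-1 * 'C(h, s.+1) + 'C(h, s.+1) * 'C(h, s) <= _).
  have : 0 < 'C(h, s) by rewrite bin_gt0 ltnW.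
  by move: 'C(h, s) 'C(h, s.+1) => x y; nia.
rewrite leq_add //; first by apply: leq_bin_double; lia.
by have := leq_mul_bin h h s.+1 s; rewrite addnn addSn addnn.
Qed.

Lemma leq_nrigid m t : 0 < t < m -> m.-1 * nrigid m t <= 'C(m, t).
Proof.
have := odd_double_half m; have := odd_double_half t; rewrite /nrigid.
move: (m./2) (t./2) => h s.
case: (odd m) (odd t) => [] [] /= <- <-; rewrite ?add0n ?add1n => bounds.
- rewrite -bin_sub; last by lia.
  rewrite -[X in _ <= X]bin_sub; last by lia.
  have -> : h.*2.+1 - s.*2.+1 = (h - s).*2 by lia.
  by apply: leq_bin_doubleS; lia.
- by apply: leq_bin_doubleS; lia.
- by rewrite muln0.
- by apply: leq_bin_double; lia.
Qed.

(* The rigid words are at most a fraction [1 / (m - 1)] of all words. *)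
Lemma leq_nwords_dvd k m a b s : 1 < k -> 0 < a + b < m ->
  2 * m.-1 * nwords m [pred w | content a b w & (k%:Z %| (moment w + s)%R)%Z]
  <= m * ncontent m a b.
Proof.
move=> k_gt1 ab_bounds; have := leq_nwords_dvd_rigid m a b s k_gt1.
have : m.-1 * nwords m [pred w | content a b w & rigid (map isSome w)]
    <= ncontent m a b.
  rewrite nwords_content_mask nwords_rigid ncontentE mulnA leq_mul2r.
  by rewrite leq_nrigid ?orbT.
case: m ab_bounds => [|m _] /=; first by rewrite ltn0 andbF.
move: (nwords _ _) (nwords _ _) (nwords _ _) => N R W R_le N_le.
rewrite mulnAC mulnC (leq_trans (leq_mul (leqnn m) N_le)) // mulnDr mulSn addnC.
by rewrite leq_add2r.
Qed.

(** * Runs and blocks *)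

Definition end_run (u : seq letter) : nat :=
  foldl (fun r x => if x == A then r.+1 else 0) 0 u.

Lemma end_runP u : exists2 u', u = u' ++ nseq (end_run u) A & last O u' != A.
Proof.
elim/last_ind: u => [|u x [u' u_eq u'_last]]; first by exists [::].
rewrite /end_run foldl_rcons -/(end_run u).
case: eqP => [-> | /eqP xnA]; last first.
  by exists (rcons u x); rewrite ?cats0 ?last_rcons.
by exists u' => //; rewrite -addn1 nseqD catA -u_eq cats1.
Qed.

Lemma end_run_gt0 u : (0 < end_run u) = (last O u == A).
Proof.
elim/last_ind: u => // u x _.
by rewrite /end_run foldl_rcons last_rcons; case: eqP.
Qed.

(* By [moment_shift_block] the moment increases strictly as the block moves to
   the right, unless it only moves past [A]s. *)
Lemma block_position_uniq k u v u' v' :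
  0 < k -> last O u != A -> last O u' != A -> u ++ v = u' ++ v' ->
  moment (u ++ nseq k A ++ v) = moment (u' ++ nseq k A ++ v') -> u = u'.
Proof.
move=> k_gt0; wlog le_uu' : u v u' v' / size u <= size u' => [le_case|].
  move=> uL u'L cat_eq mom_eq.
  case: (leqP (size u) (size u')) => [|/ltnW] le_uu'.
    exact: le_case cat_eq mom_eq.
  exact/esym/(le_case _ _ _ _ le_uu' _ _ (esym cat_eq) (esym mom_eq)).
move=> uL u'L cat_eq mom_eq; have [z u'_eq] : exists z, u' = u ++ z.
  exists (drop (size u) u'); rewrite -{1}(cat_take_drop (size u) u').
  by rewrite -(takel_cat v' le_uu') -cat_eq take_size_cat.
subst u'; have v_eq : v = z ++ v'.
  by move/eqP: cat_eq; rewrite -catA eqseq_cat // eqxx => /eqP.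
subst v; have := moment_shift_block u k z v'.
rewrite mom_eq -!catA subrr => /esym/eqP; rewrite mulf_eq0.
case/orP=> [|/eqP net_z]; first by lia.
have /net_eq_size_nil z_nil : net z = size z by lia.
by rewrite last_cat in u'L; rewrite (z_nil _ u'L) cats0.
Qed.

Local Notation marked_word n := (n.-tuple letter * 'I_n)%type.

Section Runs.
Variables (n a b : nat) (v : int).

(* A place [j] of a word of moment [v] such that the [A]s which end at [j] form
   the first [k] letters of a run. *)
Definition run_set k : {set marked_word n} :=
  [set x : marked_word n | content a b x.1 && (moment x.1 == v)
                         & end_run (take x.2.+1 x.1) == k].

Definition delete_block k (x : marked_word n) : seq letter :=
  take (x.2.+1 - k) x.1 ++ drop x.2.+1 x.1.

Lemma run_setP k x : x \in run_set k -> exists u z,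
  [/\ tval x.1 = u ++ nseq k A ++ z, last O u != A,
      size u + k = x.2.+1 & delete_block k x = u ++ z].
Proof.
case: x => w j; rewrite inE => /andP[_ /eqP end_run_k] /=.
have [u take_eq uL] := end_runP (take j.+1 w); rewrite {}end_run_k in take_eq.
have w_eq : tval w = u ++ nseq k A ++ drop j.+1 w.
  by rewrite catA -take_eq cat_take_drop.
have size_u : size u + k = j.+1.
  have := congr1 size take_eq.
  by rewrite size_cat size_nseq size_takel ?size_tuple.
exists u, (drop j.+1 w); split=> //.
by rewrite /delete_block /= -size_u addnK {1}w_eq take_size_cat.
Qed.

Lemma delete_block_inj k :
  0 < k -> {in run_set k &, injective (delete_block k)}.
Proof.
move=> k_gt0 [w j] [w' j'] wj_run wj'_run.
have [u [z [/= w_eq uL size_u ->]]] := run_setP wj_run.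
have [u' [z' [/= w'_eq u'L size_u' ->]]] := run_setP wj'_run.
move: wj_run wj'_run; rewrite !inE /=.
move=> /andP[/andP[_ /eqP mom_w] _] /andP[/andP[_ /eqP mom_w'] _] cat_eq.
have u_eq : u = u'.
  apply: (block_position_uniq k_gt0 uL u'L cat_eq).
  by rewrite -w_eq -w'_eq mom_w.
have z_eq : z = z' by move/eqP: cat_eq; rewrite u_eq eqseq_cat // eqxx => /eqP.
congr (_, _); apply: val_inj => /=; first by rewrite w_eq w'_eq u_eq z_eq.
by apply: succn_inj; rewrite -size_u -size_u' u_eq.
Qed.

Lemma leq_run_set k : 0 < k ->
  #|run_set k| <= nwords (n - k) [pred w | content (a - k) b w
    & (k%:Z %| (moment w + (moment (nseq k A) - v))%R)%Z].
Proof.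
move=> k_gt0.
apply: leq_card_nwords (delete_block_inj k_gt0) _ => -[w j] wj_run.
have [u [z [/= w_eq _ _ ->]]] := run_setP wj_run.
move: wj_run; rewrite inE w_eq /= => /andP[/andP[/contentP[wA wB] /eqP <-] _].
split.
  have := congr1 size w_eq.
  by rewrite size_tuple !size_cat size_nseq => ->; lia.
apply/andP; split.
  by apply/contentP; move: wA wB; rewrite !count_cat !count_nseq /=; lia.
have := moment_shift_block [::] k u z.
rewrite /= [moment (nseq k A ++ _)]moment_cat size_nseq.
set m := moment (u ++ nseq k A ++ z) => shift_eq.
have -> : (moment (u ++ z) + (moment (nseq k A) - m) =
    k%:Z * (net u - (size u)%:Z - net (u ++ z)))%R by lia.
exact: dvdz_mulr.
Qed.

Lemma leq_run_set_ncontent k :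
  0 < k -> #|run_set k| <= ncontent (n - k) (a - k) b.
Proof.
move/leq_run_set => run_le; apply: leq_trans run_le _.
by apply: leq_nwords => w _ /andP[].
Qed.

Lemma leq_run_set_half k : 1 < k -> 0 < a - k + b < n - k ->
  2 * (n - k).-1 * #|run_set k| <= (n - k) * ncontent (n - k) (a - k) b.
Proof.
move=> k_gt1 ab_bounds.
apply: leq_trans (leq_nwords_dvd (moment (nseq k A) - v) k_gt1 ab_bounds).
by apply: leq_mul => //; apply: leq_run_set; apply: ltnW.
Qed.

Lemma card_marked_words :
  #|[set x : marked_word n | content a b x.1 && (moment x.1 == v)
                           & tnth x.1 x.2 == A]| = a * nmoment n a b v.
Proof.
pose good := [pred w : n.-tuple letter | content a b w && (moment w == v)].
rewrite -sum1dep_card.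
rewrite -(pair_big_dep good (fun w j => tnth w j == A) (fun _ _ => 1)) /=.
rewrite (eq_bigr (fun=> a)) => [|w /andP[/contentP[<- _] _]].
  by rewrite sum_nat_cond_const mulnC /nwords -cardsE.
rewrite sum1_card -[in RHS](map_tnth_enum w) count_map cardE size_filter.
by rewrite /enum_mem filter_predT.
Qed.

Lemma leq_marked_run_sets :
  a * nmoment n a b v <= \sum_(j < a) #|run_set (a - j)|.
Proof.
rewrite -card_marked_words -sum1_card.
under [X in _ <= X]eq_bigr do rewrite -sum1_card big_mkcond.
rewrite exchange_big [X in X <= _]big_mkcond; apply: leq_sum => [[w j]] _.
case: ifP => //; rewrite inE /= => /andP[w_good /eqP wjA].
set k := end_run (take j.+1 w).
have k_gt0 : 0 < k.
  by rewrite end_run_gt0 (take_nth O) ?size_tuple // last_rcons -tnth_nth wjA.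
have k_le_a : k <= a.
  case/andP: w_good => /contentP[<- _] _.
  have [u take_eq _] := end_runP (take j.+1 w).
  by rewrite -(cat_take_drop j.+1 w) take_eq !count_cat count_nseq /= -/k; lia.
have ak_lt : a - k < a by lia.
by rewrite (bigD1 (Ordinal ak_lt)) //= inE /= w_good subKn // eqxx.
Qed.

End Runs.

Lemma moment_concentration c a b v : 0 < a ->
  c.+1 * nmoment (c + a) a b v <= ncontent (c + a) a b.
Proof.
move=> a_gt0; rewrite -(leq_pmul2l a_gt0) mulnCA -sum_ncontent_diag.
rewrite leq_mul2l /=; apply: leq_trans (leq_marked_run_sets _ _ _ _) _.
apply: leq_sum => j _; have j_lt := ltn_ord j.
apply: leq_trans (leq_run_set_ncontent _ _ _ _ _) _; first by lia.
have -> : c + a - (a - j) = c + j by lia.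
by rewrite subKn // ltnW.
Qed.

Definition flip (x : letter) : letter := omap negb x.

Lemma flipK : involutive flip. Proof. by case=> [[]|]. Qed.

Lemma count_flip x w : count_mem x (map flip w) = count_mem (flip x) w.
Proof.
by rewrite count_map; apply: eq_count => y /=; rewrite (inv_eq flipK).
Qed.

Lemma content_flip a b w : content a b (map flip w) = content b a w.
Proof. by rewrite /content !count_flip andbC. Qed.

Lemma net_flip w : (net (map flip w) = - net w)%R.
Proof. by rewrite !netE !count_flip opprB. Qed.

Lemma moment_flip w : (moment (map flip w) = - moment w)%R.
Proof.
by elim: w => //= x w ->; rewrite net_flip; case: x => [[]|] /=; lia.
Qed.

Lemma moment_concentration_flip c a b v : 0 < b ->
  c.+1 * nmoment (c + b) a b v <= ncontent (c + b) a b.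
Proof.
move=> b_gt0; have := moment_concentration c a (- v)%R b_gt0.
rewrite -(nwords_map _ (content b a) (inv_bij flipK)).
rewrite (eq_nwords _ (content_flip b a)).
rewrite -(nwords_map _ [pred w | _ & _] (inv_bij flipK)); congr (_ * _ <= _).
by apply: eq_nwords => w /=; rewrite content_flip moment_flip eqr_opp.
Qed.

(** * Cyclic words *)

Lemma count_charged w : count isSome w = count_mem A w + count_mem B w.
Proof. by elim: w => //= -[[]|] w -> //=; rewrite addnS. Qed.

(* A charged letter separates two prefixes of different net charge, one of which
   is not at the level [t]; each prefix is adjacent to two letters. *)
Lemma card_net_level n a w t : size w = n -> content a a w ->
  #|[set c : 'I_n | net (take c.+1 w) == t]| + a <= n.
Proof.
move=> size_w w_content; pose off c : nat := net (take c w) != t.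
have card_off :
    #|[set c : 'I_n | net (take c.+1 w) == t]| + \sum_(c < n) off c.+1 = n.
  rewrite -sum1dep_card big_mkcond -big_split /= -[RHS]card_ord -sum1_card.
  by apply: eq_bigr => c _; rewrite /off; case: eqP.
have sum_off : \sum_(c < n) off c = \sum_(c < n) off c.+1.
  have := big_ord_recl n (fun c : 'I_n.+1 => off c) (op := addn) (idx := 0).
  have -> : off (@ord0 n) = off n.
    rewrite /off take0 take_oversize ?size_w //.
    by rewrite (content_net w_content) subrr.
  by rewrite big_ord_recr /= addnC => /addnI ->.
have charged : a.*2 = \sum_(c < n) isSome (nth O w c).
  have [wA wB] := contentP _ _ _ w_content.
  rewrite -addnn -{1}wA -wB -count_charged -sum1_count big_mkcond.
  rewrite (big_nth O) big_mkord size_w.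
  by apply: eq_bigr => c _; case: isSome.
rewrite -[X in _ <= X]card_off leq_add2l -leq_double charged -addnn.
rewrite -{1}sum_off -big_split; apply: leq_sum => c _.
rewrite /off (take_nth O) ?size_w // net_rcons.
by case: (nth O w c) => [[]|] //=; case: eqP => //; case: eqP => //=; lia.
Qed.

Lemma card_rotr_moment n a w v : size w = n -> content a a w ->
  #|[set j : 'I_n | moment (rotr j w) == v]| + a <= n.
Proof.
move=> size_w w_content.
have moment_rotr (j : 'I_n) :
    moment (rotr j w) = (moment w + n%:Z * net (take (rev_ord j).+1 w))%R.
  rewrite /rotr moment_rot ?size_w; last first.
    by rewrite (content_net w_content) subrr.
  by rewrite /= subnSK.
have [zero0|[j0]] := set_0Vmem [set j : 'I_n | moment (rotr j w) == v].
  have [wA _] := contentP _ _ _ w_content.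
  by rewrite zero0 cards0 -wA -size_w count_size.
rewrite inE moment_rotr => /eqP v_eq.
set t := net (take (rev_ord j0).+1 w).
apply: leq_trans (card_net_level t size_w w_content).
rewrite leq_add2r -(card_imset _ rev_ord_inj) subset_leq_card //.
apply/subsetP => _ /imsetP[j + ->]; rewrite !inE moment_rotr -v_eq.
have n_neq0 : (n%:Z != 0)%R by have := ltn_ord j; lia.
by move/eqP/addrI/(mulfI n_neq0)/eqP.
Qed.

(* The words [v] for which some rotation of the cyclic word [A :: v] may have
   moment [0], when the marked [A] starts a cyclic run. *)
Definition cyclic_seed n a : pred (seq letter) :=
  [pred v | [&& content a a.+1 v, last O v != A
              & (n.+1%:Z %| moment (A :: v))%Z]].

Lemma cyclic_seed_uniq n a y r : size (y ++ r) = n ->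
  cyclic_seed n a (y ++ r) -> cyclic_seed n a (r ++ y) -> y = [::] \/ r = [::].
Proof.
rewrite size_cat => size_yr /and3P[yr_content lastr dvd_yr].
case/and3P=> _ lasty dvd_ry; rewrite !last_cat in lastr lasty.
have net_yr : (net y + net r = -1)%R.
  by rewrite -net_cat (content_net yr_content); lia.
have [le_y le_r] := (net_le_size y, net_le_size r).
have /dvdzP[q q_eq] : (n.+1%:Z %| ((size y)%:Z - net y)%R)%Z.
  have -> : ((size y)%:Z - net y =
      moment (A :: r ++ y) - moment (A :: y ++ r) - n.+1%:Z * net y)%R.
    rewrite /= !net_cat !moment_cat -size_yr intS PoszD.
    have -> : net r = (-1 - net y)%R by lia.
    by ring.
  by rewrite rpredB ?dvdz_mulr // rpredB.
have : q = 0%R \/ q = 1%R by nia.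
case=> q_val; rewrite q_val ?mul0r ?mul1r in q_eq.
  by left; apply: net_eq_size_nil lasty; lia.
by right; apply: net_eq_size_nil lastr; lia.
Qed.

Lemma leq_cyclic_seed n a : n * nwords n (cyclic_seed n a) <= ncontent n a a.+1.
Proof.
have -> : n * nwords n (cyclic_seed n a) =
    #|setX [set t : n.-tuple letter | cyclic_seed n a t] [set: 'I_n]|.
  by rewrite cardsX cardsT card_ord mulnC.
pose f (x : marked_word n) := rotr x.2 x.1.
apply: (leq_card_nwords (f := f)) => [[v j] [v' j']|[v j]];
    rewrite !inE !andbT /f /=.
  wlog le_jj' : v j v' j' / j <= j' => [le_case|] seed_v seed_v' rotr_eq.
    case: (leqP j j') => [|/ltnW] le_jj'; first exact: le_case.
    by apply/esym/le_case.
  have v'_eq : tval v' = rot (j' - j) v.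
    rewrite -[tval v'](rotrK j') -rotr_eq -{1}(subnK le_jj') rotD ?rotrK //.
    by rewrite size_rotr size_tuple subnK // ltnW.
  have size_take : size (take (j' - j) v) = j' - j.
    by rewrite size_takel // size_tuple; have := ltn_ord j'; lia.
  have := @cyclic_seed_uniq n a (take (j' - j) v) (drop (j' - j) v).
  rewrite cat_take_drop size_tuple -/(rot _ _) -v'_eq.
  case/(_ erefl seed_v seed_v') => eq_nil.
    have jj' : j = j'.
      by apply: val_inj; move: size_take; rewrite eq_nil /=; lia.
    by subst j'; congr (_, _); apply/val_inj/(can_inj (rotrK j)).
  have := size_drop (j' - j) v; rewrite eq_nil size_tuple /=.
  by have := ltn_ord j'; lia.
case/and3P=> v_content _ _; rewrite size_rotr size_tuple; split=> //.
by rewrite (perm_content _ _ (_ : perm_eq _ v)) // perm_rotr.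
Qed.

(* The marked letter is [head O (rot j w)], and its cyclic predecessor is
   [last O (rot j w)]. *)
Definition cyclic_run_set n a : {set marked_word n} :=
  [set x : marked_word n | [&& content a a x.1, moment x.1 == 0%R,
     head O (rot x.2 x.1) == A & last O (rot x.2 x.1) != A]].

Lemma leq_cyclic_run_set n a :
  #|cyclic_run_set n.+1 a.+1| <= (n - a) * nwords n (cyclic_seed n a).
Proof.
pose to_seed (x : marked_word n.+1) : n.-tuple letter * 'I_n.+1 :=
  ([tuple of behead (rot x.2 x.1)], x.2).
have to_seedE x :
    x \in cyclic_run_set n.+1 a.+1 -> rot x.2 x.1 = A :: (to_seed x).1.
  by rewrite inE /= => /and4P[_ _ + _]; case: (rot x.2 x.1) => //= y s /eqP ->.
have content_seed v : content a.+1 a.+1 (A :: v) = content a a.+1 v by [].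
pose zero_rotr v := [set j : 'I_n.+1 | moment (rotr j (A :: v)) == 0%R].
apply: (@leq_trans
  (\sum_(v : n.-tuple letter | cyclic_seed n a v) #|zero_rotr v|)).
  under eq_bigr do rewrite -sum1dep_card.
  rewrite pair_big_dep sum1dep_card.
  rewrite -(card_in_imset (f := to_seed)) => [|x y xS yS xy].
    apply/subset_leq_card/subsetP => _ /imsetP[[w j] wjS ->].
    have rot_w := to_seedE _ wjS; rewrite inE /= in rot_w *.
    move: wjS; rewrite inE /= => /and4P[w_content /eqP moment_w _ lastw].
    rewrite -rot_w rotK moment_w eqxx andbT; apply/and3P; split.
    - rewrite -content_seed -rot_w (perm_content _ _ (_ : perm_eq _ w)) //.
      by rewrite perm_rot.
    - by move: lastw; rewrite rot_w /=; case: behead.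
    rewrite -rot_w moment_rot ?moment_w ?add0r ?size_tuple ?dvdz_mulr //.
    by rewrite (content_net w_content) subrr.
  have := congr1 snd xy; rewrite /= => xy2.
  have := to_seedE _ xS; rewrite xy -(to_seedE _ yS) xy2 => /rot_inj/val_inj.
  by case: x y xy2 {xS yS xy} => [w j] [w' j'] /= -> ->.
rewrite mulnC /nwords -sum_nat_cond_const; apply: leq_sum => v.
case/and3P=> v_content _ _; have size_Av : size (A :: v) = n.+1.
  by rewrite /= size_tuple.
have := card_rotr_moment 0%R size_Av v_content.
by rewrite -/(zero_rotr v); move: #|zero_rotr v| => r; lia.
Qed.

(* A run of a linear word starts a run of the cyclic word, unless the word both
   starts and ends with [A]. *)
Lemma run_set1_not_cyclic n a (x : marked_word n.+2) :
  x \in run_set n.+2 a.+2 a.+2 0%R 1 -> x \notin cyclic_run_set n.+2 a.+2 ->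
  x.2 = ord0 /\ exists u, tval x.1 = A :: rcons u A.
Proof.
case: x => w j w_run; have [u [z [/= w_eq lastu size_u _]]] := run_setP w_run.
have {}size_u : size u = j by lia.
have rot_w : rot j w = (A :: z) ++ u by rewrite w_eq -size_u rot_size_cat.
move: w_run; rewrite !inE rot_w /= => /andP[/andP[-> ->] _] /=.
rewrite negbK last_cat => /eqP last_zu.
have u_nil : u = [::].
  case: u lastu last_zu {w_eq size_u rot_w} => //= x u /negbTE last_neq.
  by move/eqP; rewrite last_neq.
rewrite {}u_nil /= in w_eq last_zu size_u; split; first exact: val_inj.
case/lastP: z w_eq last_zu {rot_w} => [/(congr1 size)|z x w_eq].
  by rewrite size_tuple.
by rewrite last_rcons => x_eq; exists z; rewrite w_eq x_eq.
Qed.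

Definition inner (w : seq letter) : seq letter := rev (behead (rev (behead w))).

Lemma inner_cons_rcons x u y : inner (x :: rcons u y) = u.
Proof. by rewrite /inner /= rev_rcons /= revK. Qed.

Lemma moment_cons_rcons u :
  moment (A :: rcons u A) = (moment u + net u + (size u + 3)%:Z)%R.
Proof. by rewrite /= net_rcons -cats1 moment_cat /=; lia. Qed.

Lemma leq_run_set1 n a :
  #|run_set n.+2 a.+2 a.+2 0%R 1| <=
    #|cyclic_run_set n.+2 a.+2| + nmoment n a a.+2 (- n.+1%:Z).
Proof.
set R := run_set _ _ _ _ _; set C := cyclic_run_set _ _.
rewrite -(cardsID C R) leq_add ?subset_leq_card ?subsetIr //.
have innerP x : x \in R :\: C ->
    x.2 = ord0 /\ tval x.1 = A :: rcons (inner x.1) A.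
  rewrite inE => /andP[xC xR].
  have [-> [u x_eq]] := run_set1_not_cyclic xR xC.
  by rewrite x_eq inner_cons_rcons.
apply: (leq_card_nwords (f := fun x : marked_word n.+2 => inner x.1)).
  move=> [w j] [w' j'] /innerP[/= -> w_eq] /innerP[/= -> w'_eq] inner_eq.
  by congr (_, _); apply: val_inj; rewrite /= w_eq w'_eq inner_eq.
move=> [w j] wjRC; have [_ /= w_eq] := innerP _ wjRC.
move: wjRC; rewrite !inE => /andP[_ /andP[/andP[/= w_content /eqP moment0] _]].
move: (inner w) w_eq => u w_eq; have size_u : size u = n.
  by have := congr1 size w_eq; rewrite size_tuple /= size_rcons => -[].
have u_content : content a a.+2 u.
  case/contentP: w_content => wA wB; apply/contentP.
  by move: wA wB; rewrite w_eq -cats1 /= !count_cat /=; lia.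
split=> //=; rewrite u_content; apply/eqP; move: moment0.
by rewrite w_eq moment_cons_rcons (content_net u_content) size_u; lia.
Qed.

(** * Permutations and words *)

Section PermuteTuple.
Variables (T : finType) (n : nat) (t : n.-tuple T).

Definition permute_tuple (s : 'S_n) : n.-tuple T :=
  [tuple tnth t (s j) | j < n].

Lemma perm_permute_tuple s : perm_eq (permute_tuple s) t.
Proof. by apply/tuple_permP; exists s. Qed.

Lemma card_permute_fibre r :
  #|[set s | permute_tuple s == permute_tuple r]| =
  #|[set s | permute_tuple s == t]|.
Proof.
rewrite -[RHS](card_imset _ (mulgI r)); apply: eq_card => s; rewrite inE.
apply/eqP/imsetP => [sr_eq | [s' + ->]].
  exists (r^-1 * s)%g; last by rewrite mulKVg.
  rewrite inE; apply/eqP/eq_from_tnth => j; rewrite tnth_mktuple permM.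
  have := congr1 (fun u => tnth u (r^-1 j)%g) sr_eq.
  by rewrite !tnth_mktuple permKV.
rewrite inE => /eqP s'_eq; apply: eq_from_tnth => j.
by rewrite !tnth_mktuple permM -[in RHS]s'_eq tnth_mktuple.
Qed.

Lemma card_permute_tuple (P : pred (seq T)) :
  #|[set s | P (permute_tuple s)]| =
  #|[set s | permute_tuple s == t]| * nwords n [pred w | perm_eq w t & P w].
Proof.
pose permuted w := perm_eq w t && P w; rewrite -[LHS]sum1dep_card.
rewrite (partition_big permute_tuple permuted) => [|s Ps]; last first.
  by rewrite /permuted perm_permute_tuple.
rewrite mulnC /nwords -sum_nat_const; apply: eq_big => w; first by rewrite inE.
case/andP=> /tuple_permP[r w_eq] Pw.
have {}w_eq : permute_tuple r = w by apply: val_inj.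
rewrite -(card_permute_fibre r) w_eq -sum1dep_card; apply: eq_bigl => s.
by case: eqP => [->|]; rewrite ?Pw ?andbF.
Qed.

Lemma uniform_Pr_permute_tuple (P : pred (seq T)) :
  uniform_Pr [set s | P (permute_tuple s)] =
  ((nwords n [pred w | perm_eq w t & P w])%:R
   / (nwords n (fun w => perm_eq w t))%:R)%R.
Proof.
have fibre_neq0 : (#|[set s | permute_tuple s == t]|%:R != 0 :> rat)%R.
  rewrite pnatr_eq0 -lt0n; apply/card_gt0P; exists 1%g.
  by rewrite inE; apply/eqP/eq_from_tnth => j; rewrite tnth_mktuple perm1.
have card_Sn : #|{: 'S_n}| =
    #|[set s | permute_tuple s == t]| * nwords n (fun w => perm_eq w t).
  rewrite -cardsT; apply: etrans (etrans _ (card_permute_tuple xpredT)) _.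
    by apply: eq_card => s; rewrite !inE.
  by congr (_ * _); apply: eq_nwords => w /=; rewrite andbT.
rewrite /uniform_Pr card_permute_tuple card_Sn !natrM.
by rewrite -mulf_div divff // mul1r.
Qed.

End PermuteTuple.

Lemma perm_eq_content a b u v :
  size u = size v -> content a b v -> perm_eq u v = content a b u.
Proof.
have sizeE (w : seq letter) :
    size w = count_mem A w + count_mem B w + count_mem O w.
  by elim: w => //= -[[]|] w -> /=; lia.
rewrite !sizeE => size_uv /contentP[vA vB].
apply/idP/contentP => [/seq.permP uv|[uA uB]]; first by rewrite !uv.
move: size_uv; rewrite uA uB vA vB => /addnI uvO.
by apply/allP => -[[]|] _; rewrite /= ?uA ?vA ?uB ?vB ?uvO.
Qed.

Definition label a b i : letter :=
  if i < a then A else if i < a + b then B else O.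

Definition label_word n a b : n.-tuple letter := [tuple label a b j | j < n].

Lemma content_label_word n a b : a + b <= n -> content a b (label_word n a b).
Proof.
move=> ab_le_n; have -> : label_word n a b =
    nseq a A ++ nseq b B ++ nseq (n - (a + b)) O :> seq letter.
  rewrite /= (eq_map (g := label a b \o val)) // map_comp val_enum_ord.
  apply: (@eq_from_nth _ O) => [|i].
    by rewrite size_map size_iota !size_cat !size_nseq; lia.
  rewrite size_map size_iota => i_lt_n.
  rewrite (nth_map 0) ?size_iota // nth_iota // !nth_cat !size_nseq !nth_nseq.
  rewrite /label; case: ltnP => // a_le_i.
  by rewrite ltn_subLR //; case: ltnP => //; case: ltnP.
by apply/contentP; rewrite !count_cat !count_nseq /=; lia.
Qed.

(* The value [j] is taken at the position [s^-1 j]. *)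
Lemma D_moment n a b (s : 'S_n) :
  D a b s = moment (permute_tuple (label_word n a b) s^-1).
Proof.
rewrite moment_sum (reindex_inj (@perm_inj _ s)) /D big_mkcond.
rewrite [X in (_ - X)%R]big_mkcond -sumrB; apply: eq_bigr => i _.
rewrite !tnth_mktuple permK /label; case: ltnP => _ /=; first by ring.
by case: ifP => _ /=; ring.
Qed.

Lemma uniform_Pr_D n a b (v : int) : a + b <= n ->
  uniform_Pr [set s : 'S_n | D a b s == v] =
  ((nmoment n a b v)%:R / (ncontent n a b)%:R)%R.
Proof.
move=> ab_le_n; pose t := label_word n a b.
have perm_t (w : n.-tuple letter) : perm_eq w t = content a b w.
  by apply: perm_eq_content; rewrite ?size_tuple // content_label_word.
have -> : uniform_Pr [set s : 'S_n | D a b s == v] =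
    uniform_Pr [set s | moment (permute_tuple t s) == v].
  rewrite /uniform_Pr -(card_imset _ invg_inj); congr (_%:R / _)%R.
  apply: eq_card => s; rewrite inE; apply/imsetP/idP => [[r + ->]|s_v].
    by rewrite inE D_moment.
  by exists (s^-1)%g; rewrite ?inE ?D_moment invgK.
rewrite (uniform_Pr_permute_tuple t (fun w => moment w == v)).
by congr (_%:R / _%:R)%R; apply: eq_card => w; rewrite !inE /= perm_t.
Qed.

(** * The gap *)

Definition gap n a : rat :=
  (n%:R * (n%:R - 1)
   * (1 / n%:R - (nmoment n a a 0)%:R / (ncontent n a a)%:R))%R.

Lemma mul_ncontent_diag2 m a b :
  m.+2 * m.+1 * ncontent m a b = a.+2 * a.+1 * ncontent m.+2 a.+2 b.
Proof.
rewrite -mulnA mul_ncontent_diag mulnCA mul_ncontent_diag mulnA.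
by rewrite [a.+1 * _]mulnC.
Qed.

Lemma ler_nat_ratio (p q x y : nat) : 0 < q -> 0 < y ->
  (x%:R / y%:R <= p%:R / q%:R :> rat)%R = (x * q <= p * y).
Proof.
move=> q_gt0 y_gt0; rewrite ler_pdivrMr ?ltr0n // mulrAC ler_pdivlMr ?ltr0n //.
by rewrite -!natrM ler_nat.
Qed.

Section Excess.
Variables a c : nat.

Local Notation n := (c + a).+2.
Local Notation w := (ncontent (c + a) a a.+2).
Local Notation runs j := #|run_set n a.+2 a.+2 0%R (a.+2 - j)|.

(* The marks left over by the cyclic runs, in words of length [n] with [a + 2]
   letters [A] and as many [B]s. *)
Definition excess_marks : nat :=
  nmoment (c + a) a a.+2 (- (c + a).+1%:Z) + \sum_(j < a.+1) runs j.

Lemma leq_marks :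
  a.+2 * nmoment n a.+2 a.+2 0 <= #|cyclic_run_set n a.+2| + excess_marks.
Proof.
apply: leq_trans (leq_marked_run_sets _ _ _ _) _.
rewrite big_ord_recr /= addnA addnC leq_add2r.
by rewrite -[a.+2]addn1 addKn addn1; apply: leq_run_set1.
Qed.

Lemma leq_cyclic_marks : a.+1 * #|cyclic_run_set n a.+2| <= c * w.
Proof.
have cyclic_le := leq_cyclic_run_set (c + a).+1 a.+1.
have seed_le := leq_cyclic_seed (c + a).+1 a.+1.
rewrite subSS addnK in cyclic_le.
rewrite -(leq_pmul2l (ltn0Sn (c + a))) [X in _ <= X]mulnCA mul_ncontent_diag.
move: (nwords _ (content _ _)) seed_le => W seed_le.
rewrite mulnCA [X in _ <= X]mulnCA leq_mul2l /=.
apply: leq_trans (leq_mul (leqnn _) cyclic_le) _.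
by rewrite mulnCA leq_mul2l seed_le orbT.
Qed.

Hypothesis c_gt : a.+2 < c.

Lemma gap_excess :
  (a.+1%:R * (1 - excess_marks%:R / w%:R) <= gap n a.+2)%R.
Proof.
pose G : rat := (nmoment n a.+2 a.+2 0)%:R%R.
pose W : rat := (ncontent n a.+2 a.+2)%:R%R.
have w_gt0 : (0 < w%:R :> rat)%R by rewrite ltr0n ncontent_gt0 //; lia.
have W_gt0 : (0 < W)%R by rewrite ltr0n ncontent_gt0 //; lia.
have n_gt0 : (0 < n%:R :> rat)%R by rewrite ltr0n.
have n1E : (n%:R - 1 = (c + a).+1%:R :> rat)%R by rewrite -natr1 addrK.
have nn1E : (n%:R * (n%:R - 1) = a.+1%:R * a.+2%:R * W / w%:R :> rat)%R.
  rewrite -[LHS](mulfK (lt0r_neq0 w_gt0)) n1E -!natrM mul_ncontent_diag2.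
  by rewrite [a.+2 * _]mulnC.
have gapE : gap n a.+2 = ((c + a).+1%:R - a.+1%:R * (a.+2%:R * G) / w%:R)%R.
  rewrite /gap -/G -/W mulrBr {2}nn1E -n1E; move: n_gt0 W_gt0 w_gt0.
  move: (n%:R : rat)%R (w%:R : rat)%R (W) => x y z x_gt0 z_gt0 y_gt0.
  by field; rewrite !lt0r_neq0.
have : (a.+1%:R * (a.+2%:R * G) <= c%:R * w%:R + a.+1%:R * excess_marks%:R)%R.
  rewrite -!natrM -natrD ler_nat.
  apply: leq_trans (leq_mul (leqnn a.+1) leq_marks) _.
  by rewrite mulnDr leq_add2r leq_cyclic_marks.
rewrite gapE -addnS natrD -(ler_pM2r (_ : 0 < w%:R^-1)%R) ?invr_gt0 //.
rewrite [X in (_ <= X)%R]mulrDl mulfK ?lt0r_neq0 //; lra.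
Qed.

Lemma leq_runs_half j : j <= a ->
  2 * (c + j).-1 * runs j <= (c + j) * ncontent (c + j) j a.+2.
Proof.
move=> ja; have := @leq_run_set_half n a.+2 a.+2 0%R (a.+2 - j).
have -> : n - (a.+2 - j) = c + j by lia.
by rewrite subKn; [apply; lia | lia].
Qed.

Lemma leq_sum_runs_half :
  2 * c.-1 * c.+1 * (\sum_(j < a) runs j) <= c * a * w.
Proof.
rewrite mulnAC -[c * a * _]mulnA -sum_ncontent_diag mulnCA mulnC leq_mul2l /=.
rewrite !big_distrr; apply: leq_sum => j _ /=.
have run_half := leq_runs_half (ltnW (ltn_ord j)).
have c_le : (c + j) * c.-1 <= (c + j).-1 * c by nia.
move: (nwords _ _) #|_| run_half => N R run_half.
rewrite -(leq_pmul2l (_ : 0 < (c + j).-1)); last by lia.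
have {}c_le := leq_mul c_le (leqnn N).
have {}run_half := leq_mul (leqnn c.-1) run_half.
by lia.
Qed.

(* The sum of [1 / (c + 1)], [(c + a) / (2 (c + a - 1))] and
   [c a / (2 (c - 1) (c + 1))], which bound the words that start and end with
   [A], the blocks of two letters and the longer ones, respectively. *)
Definition excess_num : nat :=
  2 * (c + a).-1 * c.-1 + (c + a) * c.-1 * c.+1 + c * a * (c + a).-1.

Definition excess_den : nat := 2 * (c + a).-1 * c.-1 * c.+1.

Lemma leq_excess_marks : 0 < a ->
  excess_den * excess_marks <= excess_num * w.
Proof.
move=> a_gt0; rewrite /excess_marks big_ord_recr /=.
have := moment_concentration c a.+2 (- (c + a).+1%:Z)%R a_gt0.
have := leq_runs_half (leqnn a).
have := leq_sum_runs_half.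
rewrite /excess_den /excess_num; move: (nmoment _ _ _ _) (\sum_(j < a) _) #|_|.
move: (ncontent _ _ _) => u P S R S_le R_le P_le.
have {}P_le := leq_mul (leqnn (2 * (c + a).-1 * c.-1)) P_le.
have {}R_le := leq_mul (leqnn (c.-1 * c.+1)) R_le.
have {}S_le := leq_mul (leqnn (c + a).-1) S_le.
by lia.
Qed.

End Excess.

Lemma leq_excess_marks0 c : 2 < c ->
  2 * c.-1 * excess_marks 0 c <= c.+2 * ncontent c 0 2.
Proof.
move=> c_gt2; rewrite /excess_marks addn0 big_ord1.
have := leq_runs_half c_gt2 (leqnn 0); rewrite !addn0 => R_le.
have := moment_concentration_flip (c - 2) 0 (- c.+1%:Z)%R (isT : 0 < 2).
have -> : c - 2 + 2 = c by lia.
have -> : (c - 2).+1 = c.-1 by lia.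
move=> P_le; rewrite mulnDr addnC -[X in _ <= X * _]addn2 mulnDl leq_add //.
by rewrite -mulnA leq_mul2l P_le.
Qed.

Lemma leq_excess_ratio a c : 0 < a -> a + 4 <= c -> ~ (a = 1 /\ c = 5) ->
  3 * a.+1 * excess_num a c <= (3 * a).+2 * excess_den a c.
Proof.
move=> a_gt0 ac ac_neq; have [a1|a_gt1] : a = 1 \/ 1 < a by lia.
  have [j ->] : {j | c = j + 6} by exists (c - 6); lia.
  rewrite a1 /excess_num /excess_den.
  have -> : (j + 6 + 1).-1 = j + 6 by lia.
  have -> : (j + 6).-1 = j + 5 by lia.
  by nia.
have [i a_eq] : {i | a = i + 2} by exists (a - 2); lia.
have [j ->] : {j | c = i + j + 6} by exists (c - i - 6); lia.
rewrite {}a_eq {a_gt0 a_gt1 ac ac_neq} /excess_num /excess_den.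
have -> : (i + j + 6 + (i + 2)).-1 = 2 * i + j + 7 by lia.
have -> : (i + j + 6).-1 = i + j + 5 by lia.
by nia.
Qed.

Lemma ltn_excess_ratio a :
  0 < a -> excess_num a (a + 3) < excess_den a (a + 3).
Proof.
case: a => // a _; rewrite /excess_num /excess_den.
have -> : (a.+1 + 3 + a.+1).-1 = 2 * a + 4 by lia.
have -> : (a.+1 + 3).-1 = a + 3 by lia.
by nia.
Qed.

Lemma leq_excess_third a c : a + 4 <= c -> (a = 0 -> 10 <= c) ->
  ~ (a = 1 /\ c = 5) ->
  excess_marks a c * (3 * a.+1) <= (3 * a).+2 * ncontent (c + a) a a.+2.
Proof.
move=> ac a0c a1c5; have c_gt : a.+2 < c by lia.
have [a0|a_gt0] := posnP a.
  have c_ge10 := a0c a0; rewrite a0 addn0 in c_gt *.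
  have := leq_excess_marks0 c_gt; move: (excess_marks _ _) (nwords _ _) => X w.
  by nia.
have ratio_le := leq_excess_ratio a_gt0 ac a1c5.
have marks_le := leq_excess_marks c_gt a_gt0.
have den_gt0 : 0 < excess_den a c by rewrite !muln_gt0; lia.
rewrite -(leq_pmul2l den_gt0) mulnA.
apply: leq_trans (leq_mul marks_le (leqnn (3 * a.+1))) _.
rewrite mulnAC (mulnC (excess_num _ _)) [X in _ <= X]mulnCA.
by rewrite [X in _ <= X]mulnA leq_mul.
Qed.

Lemma gap_ge_third a c : a + 4 <= c -> (a = 0 -> 10 <= c) ->
  ~ (a = 1 /\ c = 5) -> (1 / 3 <= gap (c + a).+2 a.+2)%R.
Proof.
move=> ac a0c a1c5; have c_gt : a.+2 < c by lia.
apply: le_trans (gap_excess c_gt).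
have w_gt0 : 0 < ncontent (c + a) a a.+2 by rewrite ncontent_gt0; lia.
have := leq_excess_third ac a0c a1c5; rewrite -ler_nat_ratio //.
have -> : (3 * a).+2 = 3 * a.+1 - 1 by lia.
rewrite natrB // mulrBl divff ?pnatr_eq0 // natrM => excess_le.
have -> : (1 / 3 = a.+1%:R * (1 / (3 * a.+1%:R)) :> rat)%R.
  by rewrite !mul1r invfM mulrCA divff ?pnatr_eq0 // mulr1.
by rewrite ler_pM2l ?ltr0n // lerBrDl -lerBrDr.
Qed.

Lemma gap_gt0 a : 0 < a -> (0 < gap (a + 3 + a).+2 a.+2)%R.
Proof.
move=> a_gt0; have c_gt : a.+2 < a + 3 by lia.
apply: lt_le_trans (gap_excess c_gt); rewrite mulr_gt0 ?ltr0n // subr_gt0.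
have w_gt0 : 0 < ncontent (a + 3 + a) a a.+2 by rewrite ncontent_gt0; lia.
have den_gt0 : 0 < excess_den a (a + 3) by rewrite !muln_gt0; lia.
rewrite ltr_pdivrMr ?ltr0n // mul1r ltr_nat -(ltn_pmul2l den_gt0).
apply: leq_ltn_trans (leq_excess_marks c_gt a_gt0) _.
by rewrite ltn_pmul2r // ltn_excess_ratio.
Qed.

(** * Small cases *)

Fixpoint content_words m a b : seq (seq letter) :=
  if m is m'.+1 then
    (if a is a'.+1 then map (cons A) (content_words m' a' b) else [::])
    ++ (if b is b'.+1 then map (cons B) (content_words m' a b') else [::])
    ++ map (cons O) (content_words m' a b)
  else if (a == 0) && (b == 0) then [:: [::]] else [::].

Lemma nwords_content_words m a b P :
  nwords m [pred w | content a b w & P w] = count P (content_words m a b).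
Proof.
elim: m a b P => [|m IHm] a b P.
  by rewrite nwords0 /content /= !(eq_sym 0); case: ifP => //= _; rewrite addn0.
rewrite nwords_contentS /= !count_cat addnA count_map -IHm; congr (_ + _ + _).
  by case: a => // a; rewrite count_map IHm.
by case: b => // b; rewrite count_map IHm.
Qed.

Lemma gap_ge_third_nat n a : 0 < n -> 2 * a <= n ->
  ncontent n a a + 3 * n.-1 * (n * nmoment n a a 0)
    <= 3 * n.-1 * ncontent n a a ->
  (1 / 3 <= gap n a)%R.
Proof.
move=> n_gt0 an; have : 0 < ncontent n a a by rewrite ncontent_gt0; lia.
rewrite /gap; move: (nwords _ _) (nwords _ _) => G W.
rewrite -(ltr0n rat) -(ler_nat rat) !(natrD, natrM) => W_gt0 W_le.
have n_gt0' : (0 < n%:R :> rat)%R by rewrite ltr0n.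
have -> : (n%:R * (n%:R - 1) * (1 / n%:R - G%:R / W%:R) =
    n.-1%:R * (W%:R - n%:R * G%:R) / W%:R :> rat)%R.
  have -> : (n.-1%:R = n%:R - 1 :> rat)%R by rewrite -subn1 natrB.
  by field; rewrite !lt0r_neq0.
by rewrite ler_pdivlMr //; lra.
Qed.

Lemma gap_ge_third_small n a :
  (n, a) \in [:: (6, 2); (7, 2); (8, 2); (9, 2); (10, 2); (11, 2); (8, 3)] ->
  (1 / 3 <= gap n a)%R.
Proof.
pose third_check na := let: (n, a) := na in
  let W := 'C(n, a + a) * 'C(a + a, a) in
  let G := count (fun w => moment w == 0%R) (content_words n a a) in
  [&& 0 < n, 2 * a <= n & W + 3 * n.-1 * (n * G) <= 3 * n.-1 * W].
move=> na_small; have /and3P[n_gt0 an third] : third_check (n, a).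
  by move: (n, a) na_small; apply/allP; vm_compute.
by apply: gap_ge_third_nat => //; rewrite ncontentE nwords_content_words.
Qed.

Lemma gap_five_two : gap 5 2 = 0%R.
Proof.
rewrite /gap ncontentE nwords_content_words.
have -> : count (fun w => moment w == 0%R) (content_words 5 2 2) = 6.
  by vm_compute.
by [].
Qed.

Lemma gap_one n : 2 < n -> gap n 1 = (n%:R - 1)%R.
Proof.
move=> n_gt2; pose i0 : 'I_n := Ordinal (ltnW (ltnW n_gt2)).
pose i1 : 'I_n := Ordinal (ltnW n_gt2).
have D11 (s : 'S_n) : D 1 1 s = ((s i0).+1%:Z - (s i1).+1%:Z)%R.
  by rewrite /D (big_pred1 i0) ?(big_pred1 i1) // => i;
    apply/idP/eqP => [i_val|-> //]; apply: val_inj => /=; lia.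
rewrite /gap -uniform_Pr_D; last exact: ltnW.
have -> : [set s : 'S_n | D 1 1 s == 0%R] = set0.
  apply/setP => s; rewrite !inE D11 subr_eq0 eqz_nat eqSS.
  by apply/negP => /eqP/val_inj/perm_inj.
rewrite /uniform_Pr cards0 mul0r subr0 mul1r mulrAC divff ?mul1r //.
by rewrite pnatr_eq0; lia.
Qed.

Lemma gap_bounds n a : 0 < a -> 2 * a < n ->
  [/\ (0 <= gap n a)%R, ~ (a = 2 /\ n = 5) -> (0 < gap n a)%R
    & n <> 2 * a + 1 -> (1 / 3 <= gap n a)%R].
Proof.
move=> a_gt0 an.
suff [third pos] : (n <> 2 * a + 1 -> (1 / 3 <= gap n a)%R) /\
    (~ (a = 2 /\ n = 5) -> (0 < gap n a)%R).
  split=> //.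
  have [/andP[/eqP-> /eqP->]|an_neq] := boolP ((a == 2) && (n == 5)).
    by rewrite gap_five_two.
  by apply/ltW/pos; lia.
have [a1|a_gt1] : a = 1 \/ 1 < a by lia.
  have n_ge3 : (3%:R <= n%:R :> rat)%R by rewrite ler_nat; lia.
  by rewrite a1 gap_one; [split=> _; lra | lia].
have third : n <> 2 * a + 1 -> (1 / 3 <= gap n a)%R.
  move=> n_neq; have := @gap_ge_third_small n a.
  case: (boolP (_ \in _)) => [_ /(_ isT) //|na _].
  have [b [c [a_eq n_eq]]] : exists b c, a = b.+2 /\ n = (c + b).+2.
    by exists a.-2, (n - a); lia.
  move: na; rewrite !inE !xpair_eqE a_eq n_eq => na; apply: gap_ge_third; lia.
split=> // an_neq; have [n_eq|/eqP n_neq] := eqVneq n (2 * a + 1).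
  have -> : gap n a = gap (a.-2 + 3 + a.-2).+2 a.-2.+2 by congr gap; lia.
  by apply: gap_gt0; lia.
by have := third n_neq; lra.
Qed.

Local Open Scope ring_scope.

Theorem theorem6 (a n : nat) (ha : (0 < a)%N) (hn : (2 * a < n)%N) :
  let p : rat := uniform_Pr [set s : 'S_n | D a a s == 0] in
  [/\ p <= 1 / n%:R,
      ~ (a = 2%N /\ n = 5%N) -> p < 1 / n%:R
    & n <> (2 * a + 1)%N ->
      1 / n%:R - p >= 1 / (3%:R * n%:R * (n%:R - 1))].
Proof.
have aan : (a + a <= n)%N by lia.
have nn1_gt0 : 0 < n%:R * (n%:R - 1) :> rat.
  by rewrite mulr_gt0 ?subr_gt0 ?ltr0n ?ltr1n //; lia.
have [] := gap_bounds ha hn; rewrite /= uniform_Pr_D // /gap.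
rewrite pmulr_rge0 // pmulr_rgt0 // subr_ge0 subr_gt0 => p_le p_lt gap_third.
split=> // /gap_third; rewrite -ler_pdivrMl //; congr (_ <= _).
by rewrite -(mulrA 3%:R) !mul1r -invfM mulrC.
Qed.
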